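(* Let $\mathfrak{q}$ be an $n\times n$ quantum parameter matrix over a field $k$, let $V$ be an $n$-dimensional $k$-vector space with basis $v_1,\dots,v_n$, and let $B_1,\dots,B_r$ be the blocks of $\mathfrak{q}$. Let $\mathcal{P}$ be the partition of $[r]^2=[r]\times[r]$ given by $(i,j)\sim(\ell,m)$ if $\mathfrak{q}_{B_iB_j}=\mathfrak{q}_{B_\ell B_m}$ (equality of matrices). Then $$\mathrm{Aut}_{\mathrm{gr}}(S_{\mathfrak{q}}(V))\ \cong\ \Big(\prod_{i=1}^{s}\mathrm{GL}(\lambda_i,k)^{m_i}\Big)\rtimes G$$ for some integer partition $\lambda=(\lambda_1^{m_1}\cdots\lambda_s^{m_s})$ of $\dim V$ with $\sum_i m_i=r$, and $G$ the maximal subgroup of $\mathfrak{S}_r$ such that the orbit space $[r]^2/G$ (for the diagonal action of $\mathfrak{S}_r$ on $[r]^2$) refines $\mathcal{P}$. Here $G=\mathrm{Stab}(\mathfrak{q})$, and $G$ acts by a subgroup of $\prod_{i=1}^s\mathfrak{S}_{m_i}$, where each $\mathfrak{S}_{m_i}$ permutes the $m_i$ copies of $\mathrm{GL}(\lambda_i,k)$.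
   Context: Let $k$ be a field. An $n\times n$ quantum parameter matrix is a matrix $\mathfrak{q}=(q_{ij})$ with entries in $k$ such that $q_{ii}=1$ and $q_{ij}q_{ji}=1$ for all $i,j$. For an $n$-dimensional $k$-vector space $V$ with fixed basis $v_1,\dots,v_n$, the skew polynomial algebra $S_{\mathfrak{q}}(V)$ is the $k$-algebra generated by $v_1,\dots,v_n$ subject to $v_jv_i=q_{ij}v_iv_j$ for all $i,j$, graded by $\deg v_i=1$. $\mathrm{Aut}_{\mathrm{gr}}(S_{\mathfrak{q}}(V))$ is the group of degree-preserving $k$-algebra automorphisms, regarded as a subgroup of $\mathrm{GL}(V)=\mathrm{GL}(n,k)$ via restriction to $V$. Write $[n]=\{1,\dots,n\}$. For $B,C\subseteq[n]$ let $\mathfrak{q}_{BC}=(q_{ij})_{i\in B,j\in C}$. The blocks of $\mathfrak{q}$ are the classes of the partition $\mathcal{B}_{\mathfrak{q}}$ of $[n]$ with $i\sim j$ iff rows $i$ and $j$ of $\mathfrak{q}$ are identical; for blocks $B,C$ all entries of $\mathfrak{q}_{BC}$ are equal. With $r=|\mathcal{B}_{\mathfrak{q}}|$, the symmetric group $\mathfrak{S}_r$ acts on $\mathcal{B}_{\mathfrak{q}}$ by permuting blocks, and $\mathrm{Stab}(\mathfrak{q})=\{\sigma\in\mathfrak{S}_r: |\sigma(B)|=|B| \text{ and } \mathfrak{q}_{BC}=\mathfrak{q}_{\sigma(B)\sigma(C)}\text{ for all blocks }B,C\}$. A partition $Q$ refines $\mathcal{P}$ if every block of $Q$ is contained in a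 block of $\mathcal{P}$. A partition $(\lambda_1^{m_1}\cdots\lambda_s^{m_s})$ has distinct parts $\lambda_1,\dots,\lambda_s$ with multiplicities $m_i$. *)

(* Defs.v *)
From HB Require Import structures.
From mathcomp Require Import all_boot all_order all_algebra all_fingroup.
From mathcomp Require Import mpoly.
Set Implicit Arguments. Unset Strict Implicit. Unset Printing Implicit Defensive.
Import Order.TTheory GRing.Theory.
Local Open Scope ring_scope.

Section Defs.
Variables (k : fieldType) (n : nat).

Definition qparam (q : 'M[k]_n) : Prop :=
  (forall i, q i i = 1) /\ (forall i j, q i j * q j i = 1).

(* ---------- The skew polynomial algebra S_q(V) ----------
   Concrete model on the vector space {mpoly k[n]} with basis the ordered
   monomials v^a = v_0^{a_0} ... v_{n-1}^{a_{n-1}}  ('X_[a]),  v_i = 'X_i.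
   Using v_j v_i = q_ij v_i v_j, one has v^a v^b = qcoef a b v^(a+b)
   with qcoef a b = prod_{j < i} q_ji^(a_i b_j). *)
Definition qcoef (q : 'M[k]_n) (a b : 'X_{1..n}) : k :=
  \prod_(i < n) \prod_(j < n | (j < i)%N) q j i ^+ (a i * b j).

Definition qmul (q : 'M[k]_n) (p p' : {mpoly k[n]}) : {mpoly k[n]} :=
  \sum_(a <- msupp p) \sum_(b <- msupp p')
     (p@_a * p'@_b * qcoef q a b) *: 'X_[a + b].

Definition homog_deg (d : nat) (p : {mpoly k[n]}) : bool :=
  all (fun m : 'X_{1..n} => mdeg m == d) (msupp p).

Definition graded_aut (q : 'M[k]_n) (f : {mpoly k[n]} -> {mpoly k[n]}) : Prop :=
  [/\ forall (c : k) p p', f (c *: p + p') = c *: f p + f p',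
      bijective f,
      f 1 = 1,
      forall p p', f (qmul q p p') = qmul q (f p) (f p')
    & forall d p, homog_deg d p -> homog_deg d (f p)].

(* Aut_gr(S_q(V)) as a subset of GL(V) = GL(n,k) via restriction to V:
   g is the matrix of f|_V in the basis v_1..v_n (f v_j = sum_i g_ij v_i). *)
Definition AutGr (q : 'M[k]_n) (g : 'M[k]_n) : Prop :=
  exists f, graded_aut q f /\
    forall j : 'I_n, f 'X_j = \sum_(i < n) g i j *: 'X_i.

Definition block_labeling (q : 'M[k]_n) (r : nat) (blk : 'I_n -> 'I_r) : Prop :=
  (forall a : 'I_r, exists i, blk i = a) /\
  (forall i j, blk i = blk j <-> row i q = row j q).

Definition blockset r (blk : 'I_n -> 'I_r) (a : 'I_r) : {set 'I_n} :=
  [set i | blk i == a].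

(* the submatrix q_{BC}, as its list of rows (so equality of such
   matrices includes equality of their shapes) *)
Definition subq (q : 'M[k]_n) (B C : {set 'I_n}) : seq (seq k) :=
  [seq [seq q i j | j <- enum C] | i <- enum B].

Definition Prel (q : 'M[k]_n) r (blk : 'I_n -> 'I_r) (ab lm : 'I_r * 'I_r) : bool :=
  subq q (blockset blk ab.1) (blockset blk ab.2)
  == subq q (blockset blk lm.1) (blockset blk lm.2).

Definition Stab (q : 'M[k]_n) r (blk : 'I_n -> 'I_r) : {set 'S_r} :=
  [set s : 'S_r | [forall a, #|blockset blk (s a)| == #|blockset blk a|] &&
     [forall a, forall b, subq q (blockset blk a) (blockset blk b)
                          == subq q (blockset blk (s a)) (blockset blk (s b))]].

Definition orbits_refine (q : 'M[k]_n) r (blk : 'I_n -> 'I_r) (H : {set 'S_r}) : Prop :=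
  forall ab lm : 'I_r * 'I_r,
    (exists2 s, s \in H & (s ab.1, s ab.2) = lm) -> Prel q blk ab lm.

Definition GLfam s (lam m : 'I_s -> nat) :=
  forall i : 'I_s, 'I_(m i) -> 'M[k]_(lam i).

Definition inGL s (lam m : 'I_s -> nat) (x : GLfam lam m) : Prop :=
  forall i c, x i c \in unitmx.

Definition GLmul s (lam m : 'I_s -> nat) (x y : GLfam lam m) : GLfam lam m :=
  fun i c => x i c *m y i c.

(* action of sigma through rho : each rho i sigma permutes the m_i copies
   of GL(lam_i,k) (a left action for MathComp's permutation product) *)
Definition GLact r s (lam m : 'I_s -> nat)
  (rho : forall i : 'I_s, 'S_r -> {perm 'I_(m i)}) (sg : 'S_r) (y : GLfam lam m)
  : GLfam lam m :=
  fun i c => y i (rho i sg c).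

End Defs.

(* Main.v *)
(** The relations of S_q(V) force a graded automorphism g to satisfy q_ab = q_ij
whenever g_ai and g_bj are nonzero (if a nonzero column of g met two rows a, b
with q_ab <> 1, then those two rows would be proportional). Hence g permutes the
blocks, by an element of the stabilizer, and is a block monomial matrix.

Conversely, S_q(V) is k[x_1..x_n] with its product twisted by a 2-cocycle. After
rescaling the monomials, which changes the cocycle by a coboundary, the cocycle
depends only on the block multidegrees, so that the commutative substitution
defined by a block monomial matrix respects it. *)
Require Import Defs.
From HB Require Import structures.
From mathcomp Require Import all_boot all_order all_algebra all_fingroup.
From mathcomp Require Import mpoly.
From mathcomp Require Import ssrcomplements zify ring.
Set Implicit Arguments.
Unset Strict Implicit.
Import GRing.Theory.
Local Open Scope ring_scope.

(** * Linear maps on [{mpoly k[n]}] given by their values on monomials *)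

Section LinearExtension.
Variables (k : fieldType) (n : nat) (V : lmodType k).
Implicit Types (phi : 'X_{1..n} -> V) (p : {mpoly k[n]}).

Definition linext phi p : V := \sum_(a <- msupp p) p@_a *: phi a.

(** The supports of [p], [p'] and [c *: p + p'] differ; linearity is checked on a sum over one index
    set large enough for all three. *)
Lemma linext_wide d phi p : (msize p <= d)%N ->
  linext phi p = \sum_(a : 'X_{1..n < d}) p@_a *: phi a.
Proof.
move=> le_pd; rewrite /linext (big_mksub 'X_{1..n < d}) ?msupp_uniq //=.
  by rewrite big_rmcond //= => a /memN_msupp_eq0 ->; rewrite scale0r.
by move=> a /msize_mdeg_lt/leq_trans; apply.
Qed.

Lemma linextP c phi p p' :
  linext phi (c *: p + p') = c *: linext phi p + linext phi p'.
Proof.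
pose d := maxn (msize (c *: p + p')) (maxn (msize p) (msize p')).
rewrite !(@linext_wide d) ?leq_max ?leqnn ?orbT //.
rewrite scaler_sumr -big_split /=; apply: eq_bigr => a _.
by rewrite linearP /= scalerDl scalerA.
Qed.

HB.instance Definition _ phi := GRing.isLinear.Build k {mpoly k[n]} V _
  (linext phi) (fun c p p' => linextP c phi p p').

Lemma linextX phi a : linext phi 'X_[a] = phi a.
Proof. by rewrite /linext msuppX big_seq1 mcoeffX eqxx scale1r. Qed.

Lemma eq_linext phi phi' p : phi =1 phi' -> linext phi p = linext phi' p.
Proof. by move=> e; apply: eq_bigr => a _; rewrite e. Qed.

Lemma linear_linext (f : {linear {mpoly k[n]} -> V}) p :
  f p = linext (fun a => f 'X_[a]) p.
Proof. by rewrite {1}[p]mpolyE linear_sum; apply: eq_bigr => a _; rewrite linearZ. Qed.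

Lemma eq_linear_mpoly (f h : {linear {mpoly k[n]} -> V}) :
  (forall a, f 'X_[a] = h 'X_[a]) -> f =1 h.
Proof. by move=> fh p; rewrite [f p]linear_linext [h p]linear_linext; exact: eq_linext. Qed.

Lemma linextDr phi psi p :
  linext (fun a => phi a + psi a) p = linext phi p + linext psi p.
Proof. by rewrite -big_split; apply: eq_bigr => a _; rewrite scalerDr. Qed.

Lemma linextZr c phi p : linext (fun a => c *: phi a) p = c *: linext phi p.
Proof. by rewrite scaler_sumr; apply: eq_bigr => a _; rewrite !scalerA mulrC. Qed.

End LinearExtension.

(** * Twisted products of monomials, rescalings and linear substitutions *)

Section TwistedProduct.
Variables (k : fieldType) (n : nat).
Local Notation mon := 'X_{1..n}.
Local Notation A := {mpoly k[n]}.
Implicit Types (C : mon -> mon -> k) (f : {linear A -> A}).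

Definition tmul C (p p' : A) : A :=
  linext (fun a => linext (fun b => C a b *: 'X_[(a + b)%MM]) p') p.

Lemma qmulE q : qmul q =2 tmul (qcoef q).
Proof.
move=> p p'; apply: eq_bigr => a _; rewrite scaler_sumr; apply: eq_bigr => b _.
by rewrite !scalerA.
Qed.

Lemma tmul_is_linearl C p' : linear (fun p => tmul C p p').
Proof. by move=> c p1 p2; rewrite /tmul linextP. Qed.

Lemma tmul_is_linearr C p : linear (tmul C p).
Proof.
move=> c p1 p2; rewrite /tmul -linextZr -linextDr.
by apply: eq_linext => a; rewrite linextP.
Qed.

HB.instance Definition _ C p :=
  GRing.isLinear.Build k A A _ (tmul C p) (@tmul_is_linearr C p).

(** Swapping the arguments lets linearity in the left factor be registered as a linear structure. *)
Definition tmulr C p' p : A := tmul C p p'.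

HB.instance Definition _ C p' :=
  GRing.isLinear.Build k A A _ (tmulr C p') (@tmul_is_linearl C p').

Lemma tmulXX C a b : tmul C 'X_[a] 'X_[b] = C a b *: 'X_[(a + b)%MM].
Proof. by rewrite /tmul !linextX. Qed.

Lemma tmulZl C c p p' : tmul C (c *: p) p' = c *: tmul C p p'.
Proof. by rewrite -![tmul C _ p']/(tmulr C p' _) linearZ. Qed.

Lemma tmulZr C c p p' : tmul C p (c *: p') = c *: tmul C p p'.
Proof. exact: linearZ. Qed.

Lemma tmul_morphism C C' f :
  (forall a b, f (tmul C 'X_[a] 'X_[b]) = tmul C' (f 'X_[a]) (f 'X_[b])) ->
  {morph f : p p' / tmul C p p' >-> tmul C' p p'}.
Proof.
move=> fX p p'.
apply: (@eq_linear_mpoly _ _ _ (f \o tmulr C p') (tmulr C' (f p') \o f)).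
move=> a /=; rewrite /tmulr.
apply: (@eq_linear_mpoly _ _ _ (f \o tmul C 'X_[a]) (tmul C' (f 'X_[a]) \o f)).
by move=> b; exact: fX.
Qed.

Lemma tmul_constant C x p p' :
  (forall a b, a \in msupp p -> b \in msupp p' -> C a b = x) ->
  tmul C p p' = x *: (p * p').
Proof.
move=> Cx; rewrite mpolyME big_allpairs scaler_sumr [LHS]big_seq [RHS]big_seq.
apply: eq_bigr => a pa; rewrite !scaler_sumr [LHS]big_seq [RHS]big_seq.
by apply: eq_bigr => b pb; rewrite Cx // !scalerA mulrC mulrA.
Qed.

Definition rescale (t : mon -> k) : A -> A := linext (fun a => t a *: 'X_[a]).

HB.instance Definition _ t := GRing.Linear.on (rescale t).

Lemma rescaleX t a : rescale t 'X_[a] = t a *: 'X_[a].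
Proof. exact: linextX. Qed.

Lemma rescaleK t u : (forall a, t a * u a = 1) -> cancel (rescale t) (rescale u).
Proof.
move=> tu; apply: (@eq_linear_mpoly _ _ _ (rescale u \o rescale t) idfun) => a /=.
by rewrite rescaleX linearZ /= rescaleX scalerA tu scale1r.
Qed.

(** The hypothesis says that [C] and [C'] differ by the coboundary of [t]. *)
Lemma rescale_morphism t C C' :
  (forall a b, C a b * t (a + b)%MM = t a * t b * C' a b) ->
  {morph rescale t : p p' / tmul C p p' >-> tmul C' p p'}.
Proof.
move=> tC; apply: tmul_morphism => a b.
rewrite tmulXX linearZ /= !rescaleX tmulZl tmulZr tmulXX !scalerA.
by rewrite tC.
Qed.

Lemma msupp_rescale t p : {subset msupp (rescale t p) <= msupp p}.
Proof.
rewrite /rescale /linext => c /msupp_sum_le /flattenP[s /mapP[a]].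
rewrite filter_predT => pa ->{s} /msuppZ_le/msuppZ_le.
by rewrite msuppX inE => /eqP ->.
Qed.

Definition column_forms (g : 'M[k]_n) : n.-tuple A :=
  [tuple \sum_(i < n) g i j *: 'X_i | j < n].

Definition subst_mx (g : 'M[k]_n) : A -> A := comp_mpoly (column_forms g).

HB.instance Definition _ g :=
  GRing.RMorphism.copy (subst_mx g) (comp_mpoly (column_forms g)).
HB.instance Definition _ g :=
  GRing.Linear.copy (subst_mx g) (comp_mpoly (column_forms g)).

Lemma subst_mxX g j : subst_mx g 'X_j = \sum_(i < n) g i j *: 'X_i.
Proof. by rewrite /subst_mx comp_mpolyXU -tnth_nth tnth_mktuple. Qed.

Lemma subst_mxM g h p : subst_mx g (subst_mx h p) = subst_mx (g *m h) p.
Proof.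
apply: (@eq_linear_mpoly _ _ _ (subst_mx g \o subst_mx h) (subst_mx (g *m h))).
move=> a /=; rewrite mpolyXE_id !rmorph_prod; apply: eq_bigr => j _ /=.
rewrite !rmorphXn /= !subst_mxX linear_sum; congr (_ ^+ _).
under eq_bigr => l _ do rewrite linearZ /= subst_mxX scaler_sumr.
rewrite exchange_big; apply: eq_bigr => i _; rewrite mxE scaler_suml.
by apply: eq_bigr => l _; rewrite scalerA mulrC.
Qed.

Lemma subst_mx1 p : subst_mx 1%:M p = p.
Proof.
rewrite -[RHS]comp_mpoly_id; congr comp_mpoly; apply: eq_mktuple => j.
rewrite (bigD1 j) //= mxE eqxx scale1r big1 ?addr0 // => i ij.
by rewrite mxE (negPf ij) scale0r.
Qed.

End TwistedProduct.

(** * Structure constants in terms of block multidegrees; automorphisms from block monomial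
    matrices *)

Section BlockDegree.
Variables (k : fieldType) (n r : nat) (q : 'M[k]_n).
Hypothesis qP : qparam q.
Variable Q : 'I_r -> 'I_r -> k.
Local Notation mon := 'X_{1..n}.
Implicit Types (w : 'I_n -> 'I_r) (a b c d : mon).

(** The multidegree of v^a for the grading in which v_i has degree the basis vector labeled
    [w i]. *)
Definition wdeg w a (x : 'I_r) : nat := (\sum_(i | w i == x) a i)%N.

Lemma wdeg0 w x : wdeg w 0%MM x = 0%N.
Proof. by rewrite /wdeg big1 // => i _; rewrite mnm0E. Qed.

Lemma wdegD w a b x : wdeg w (a + b)%MM x = (wdeg w a x + wdeg w b x)%N.
Proof. by rewrite -big_split; apply: eq_bigr => i _; rewrite mnmDE. Qed.

Lemma wdegU w i x : wdeg w U_(i)%MM x = (w i == x).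
Proof.
rewrite /wdeg big_mkcond (bigD1 i) //= big1 ?addn0 ?mnm1E ?eqxx; first by case: eqP.
by move=> j ji; rewrite mnm1E [i == j]eq_sym (negPf ji) if_same.
Qed.

Lemma sum_wdeg w a : (\sum_x wdeg w a x)%N = mdeg a.
Proof. by rewrite mdegE [RHS](partition_big w xpredT). Qed.

Definition block_coef w a b : k :=
  \prod_(x < r) \prod_(y < r | (y < x)%N) Q y x ^+ (wdeg w a x * wdeg w b y).

(** [reorder_coef w a] times v^a is the monomial with the factors of v^a sorted by
    increasing [w], and [block_coef w] gives the structure constants of S_q(V) in
    the basis of these sorted monomials. *)
Definition reorder_coef w a : k :=
  \prod_(i < n) \prod_(j < n | (j < i)%N && (w i < w j)%N) q j i ^+ (a i * a j).

Lemma reorder_coef_neq0 w a : reorder_coef w a != 0.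
Proof.
apply/prodf_neq0 => i _; apply/prodf_neq0 => j _; apply: expf_neq0.
by apply/eqP => q0; have /eqP := qP.2 j i; rewrite q0 mul0r eq_sym oner_eq0.
Qed.

Lemma reorder_coef0 w : reorder_coef w 0%MM = 1.
Proof. by rewrite /reorder_coef !big1 // => i _; rewrite big1 // => j _; rewrite mnm0E. Qed.

Lemma reorder_coefU w l : reorder_coef w U_(l)%MM = 1.
Proof.
rewrite /reorder_coef big1 // => i _; rewrite big1 // => j /andP[ji _].
rewrite !mnm1E; case: eqP => [->|]; last by rewrite mul0n expr0.
by case: eqP => // e; rewrite e ltnn in ji.
Qed.

Section Compare.
Variable w : 'I_n -> 'I_r.
Hypothesis qQ : forall i j, q i j = Q (w i) (w j).

Lemma block_coefE a b :
  block_coef w a b = \prod_i \prod_(j | (w j < w i)%N) q j i ^+ (a i * b j).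
Proof.
rewrite [RHS](partition_big w xpredT) //=; apply: eq_bigr => x _.
have -> : \prod_(i | w i == x) \prod_(j | (w j < w i)%N) q j i ^+ (a i * b j)
   = \prod_(i | w i == x) \prod_(y < r | (y < x)%N) Q y x ^+ (a i * wdeg w b y).
  apply: eq_bigr => i /eqP wi.
  rewrite (partition_big w (fun y : 'I_r => (y < x)%N)) /= => [|j]; last by rewrite wi.
  apply: eq_bigr => y yx; rewrite big_distrr -prodrXr.
  apply: eq_big => [j|j /andP[_ /eqP wj]]; last by rewrite qQ wi wj.
  by case: eqP => [->|_]; rewrite ?andbF // wi yx.
rewrite exchange_big; apply: eq_bigr => y _.
by rewrite /wdeg big_distrl -prodrXr.
Qed.

(** [reorder_coef w] is quadratic in the exponent, so passing to a + b leaves the cross terms [T].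
    Each pair j < i is then checked separately: labels in the same order need no correction,
    reversed labels cancel by q_ij q_ji = 1, and equal labels force q_ji = 1. *)
Lemma qcoef_block a b :
  qcoef q a b * reorder_coef w a * reorder_coef w b
  = block_coef w a b * reorder_coef w (a + b)%MM.
Proof.
pose T (i j : 'I_n) : k := if (j < i)%N && (w i < w j)%N then
   q j i ^+ (a i * b j) * q j i ^+ (b i * a j) else 1.
have -> : reorder_coef w (a + b)%MM =
    \prod_i \prod_j T i j * (reorder_coef w a * reorder_coef w b).
  rewrite /reorder_coef -!big_split /=; apply: eq_bigr => i _.
  rewrite /T -big_mkcond -!big_split /=; apply: eq_bigr => j _.
  by rewrite !mnmDE -!exprD; congr (_ ^+ _); rewrite mulnDl !mulnDr; lia.
rewrite !mulrA -mulrA -[in RHS]mulrA; congr (_ * _).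
rewrite block_coefE.
have -> : \prod_i \prod_(j | (w j < w i)%N) q j i ^+ (a i * b j) =
   \prod_(i < n) \prod_(j < n) ((if (j < i)%N && (w j < w i)%N then q j i ^+ (a i * b j) else 1) *
       (if (j < i)%N && (w i < w j)%N then q i j ^+ (a j * b i) else 1)).
  under [RHS]eq_bigr => i _ do rewrite big_split.
  rewrite big_split /= [X in _ * X]exchange_big -big_split; apply: eq_bigr => i _.
  rewrite -big_split big_mkcond; apply: eq_bigr => j _ /=.
  case: (ltngtP i j) => [ij|ij|/val_inj ->]; rewrite ?mulr1 ?mul1r ?ltnn //.
rewrite -big_split; apply: eq_bigr => i _; rewrite -big_split big_mkcond.
apply: eq_bigr => j _ /=; rewrite /T.
case: (ltnP j i) => ji /=; last by rewrite !mulr1.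
case: (ltngtP (w i) (w j)) => [ij|ij|/val_inj ij]; rewrite ?mulr1 ?mul1r //.
  by rewrite mulrCA [(a j * b i)%N]mulnC -exprMn (qP.2) expr1n mulr1.
by rewrite qQ ij -qQ (qP.1) expr1n.
Qed.

End Compare.

(** This rescaling passes to coordinates in the basis of sorted monomials. *)
Lemma rescale_qmul w (qQ : forall i j, q i j = Q (w i) (w j)) :
  {morph rescale (fun a => (reorder_coef w a)^-1) :
    p p' / qmul q p p' >-> tmul (block_coef w) p p'}.
Proof.
move=> p p'; rewrite qmulE; apply: rescale_morphism => a b.
have := qcoef_block qQ a b.
move: (reorder_coef_neq0 w a) (reorder_coef_neq0 w b) (reorder_coef_neq0 w (a + b)%MM).
move: (reorder_coef w a) (reorder_coef w b) (reorder_coef w (a + b)%MM) => x y z.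
move=> x0 y0 z0 e; apply: (mulIf z0); rewrite mulfVK // -[RHS]mulrA -e.
by field; rewrite x0 y0.
Qed.

Lemma rescale_tmul w (qQ : forall i j, q i j = Q (w i) (w j)) :
  {morph rescale (reorder_coef w) :
    p p' / tmul (block_coef w) p p' >-> qmul q p p'}.
Proof.
move=> p p'; rewrite qmulE; apply: rescale_morphism => a b.
by rewrite -qcoef_block //; ring.
Qed.

Section Substitution.
Variables (g : 'M[k]_n) (w w' : 'I_n -> 'I_r).
Hypothesis gw : forall i j, g i j != 0 -> w j = w' i.

(** By [gw] each variable goes to a form of the same multidegree, measured by [w] at the source and
    by [w'] at the target; multidegrees add under products. *)
Lemma wdeg_subst_mx a c : c \in msupp (subst_mx g 'X_[a]) -> wdeg w' c =1 wdeg w a.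
Proof.
pose K a := forall c, c \in msupp (subst_mx g 'X_[a]) -> wdeg w' c =1 wdeg w a.
have K0 : K 0%MM.
  by move=> {}c; rewrite mpolyX0 rmorph1 msupp1 inE => /eqP -> x; rewrite !wdeg0.
have KD a1 a2 : K a1 -> K a2 -> K (a1 + a2)%MM.
  move=> K1 K2 {}c; rewrite mpolyXD rmorphM.
  case/msuppM_le/allpairsP=> -[c1 c2] /= [/K1 e1 /K2 e2 ->] x.
  by rewrite !wdegD e1 e2.
have KU i : K U_(i)%MM.
  move=> {}c; rewrite subst_mxX => /msupp_sum_le/flattenP[s /mapP[l]].
  rewrite filter_predT => _ -> {s}; case: (eqVneq (g l i) 0) => [->|/gw e].
    by rewrite scale0r msupp0.
  by move/msuppZ_le; rewrite msuppX inE => /eqP -> x; rewrite !wdegU e.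
suff: K a by apply.
rewrite [a]multinomUE_id; elim/big_ind: _ => // i _.
by elim: (a i) => [|m IH]; rewrite ?mulm0n ?mulmS //; apply: KD.
Qed.

(** The monomials in the image of one monomial share their multidegree, so the twist is a constant
    there and multiplicativity of the commutative substitution is enough. *)
Lemma subst_mx_tmul :
  {morph subst_mx g : p p' / tmul (block_coef w) p p' >-> tmul (block_coef w') p p'}.
Proof.
apply: tmul_morphism => a b.
rewrite tmulXX linearZ /= mpolyXD rmorphM /=; symmetry.
apply: tmul_constant => c d /wdeg_subst_mx ec /wdeg_subst_mx ed.
by apply: eq_bigr => x _; apply: eq_bigr => y _; rewrite ec ed.
Qed.

Lemma homog_subst_mx (d : nat) p : homog_deg d p -> homog_deg d (subst_mx g p).
Proof.
move=> /allP hp; apply/allP => c; rewrite {1}[p]mpolyE linear_sum.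
move=> /msupp_sum_le/flattenP[s /mapP[a]]; rewrite filter_predT => pa -> {s}.
rewrite linearZ => /msuppZ_le/wdeg_subst_mx e; rewrite -(eqP (hp a pa)) /=.
by rewrite -(sum_wdeg w a) -(sum_wdeg w' c); apply/eqP/eq_bigr => x _; exact: e.
Qed.

Hypotheses (gU : g \in unitmx) (qw : forall i j, q i j = Q (w i) (w j)).
Hypothesis (qw' : forall i j, q i j = Q (w' i) (w' j)).

(** The automorphism passes to the monomials sorted by [w], substitutes, and returns from those
    sorted by [w']; both bases have the same structure constants as functions of multidegrees. The
    rescalings fix the variables, so the restriction to V is [g]. *)
Lemma subst_mx_AutGr : AutGr q g.
Proof.
pose D := rescale (fun a => (reorder_coef w a)^-1).
pose D' := rescale (reorder_coef w').
exists (D' \o subst_mx g \o D); split; [split|] => /=.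
- by move=> c p p'; rewrite /D /D' !linearP.
- have rescale_bij t : (forall a, t a != 0) -> bijective (@rescale k n t).
    move=> t0; exists (rescale (fun a => (t a)^-1)); apply: rescaleK => a;
      by rewrite ?mulVf ?mulfV.
  have subst_bij : bijective (subst_mx g).
    exists (subst_mx (invmx g)) => p; by rewrite subst_mxM ?mulmxV ?mulVmx ?subst_mx1.
  apply: (bij_comp (bij_comp (rescale_bij _ _) subst_bij) (rescale_bij _ _)) => a.
    exact: reorder_coef_neq0.
  by rewrite invr_eq0 reorder_coef_neq0.
- rewrite -mpolyX0 /D rescaleX reorder_coef0 invr1 scale1r mpolyX0 rmorph1.
  by rewrite -mpolyX0 /D' rescaleX reorder_coef0 scale1r.
- by move=> p p' /=; rewrite /D /D' rescale_qmul // subst_mx_tmul rescale_tmul.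
- move=> d p hp; have hD : homog_deg d (D p).
    by apply/allP => c /msupp_rescale; apply: (allP hp).
  by apply/allP => c /msupp_rescale; apply: (allP (homog_subst_mx hD)).
- move=> j; rewrite /D rescaleX reorder_coefU invr1 scale1r subst_mxX /D' linear_sum.
  apply: eq_bigr => i _; rewrite linearZ /= rescaleX reorder_coefU.
  by rewrite scale1r.
Qed.

End Substitution.
End BlockDegree.

(** * Constraints imposed on a graded automorphism by the quadratic relations *)

Section QuadraticRelations.
Variables (k : fieldType) (n : nat) (q : 'M[k]_n).
Hypothesis qP : qparam q.

Lemma qparam_neq0 i j : q i j != 0.
Proof. by apply/eqP => q0; have /eqP := qP.2 i j; rewrite q0 mul0r eq_sym oner_eq0. Qed.

Lemma qcoefUU (a b : 'I_n) :
  qcoef q U_(a)%MM U_(b)%MM = if (b < a)%N then q b a else 1.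
Proof.
rewrite /qcoef (bigD1 a) //= [X in _ * X]big1 ?mulr1; last first.
  by move=> i ia; rewrite big1 // => j _; rewrite !mnm1E [a == i]eq_sym (negPf ia) expr0.
rewrite big_mkcond (bigD1 b) //= big1 ?mulr1 ?mnm1E ?eqxx //.
by move=> j jb; rewrite !mnm1E [b == j]eq_sym (negPf jb) muln0 expr0 if_same.
Qed.

Lemma qcoefUU_neq0 a b : qcoef q U_(a)%MM U_(b)%MM != 0.
Proof. by rewrite qcoefUU; case: ifP; rewrite ?oner_neq0 ?qparam_neq0. Qed.

(** The defining relation v_j v_i = q_ij v_i v_j, read on structure constants. *)
Lemma qcoefUUC i j :
  qcoef q U_(j)%MM U_(i)%MM = q i j * qcoef q U_(i)%MM U_(j)%MM.
Proof.
rewrite !qcoefUU; case: (ltngtP i j) => [ij|ij|/val_inj ->]; rewrite ?mulr1 ?qP.1 //.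
by rewrite qP.2.
Qed.

Lemma mnmUU_eq (a b c d : 'I_n) :
  ((U_(c) + U_(d))%MM == (U_(a) + U_(b))%MM) =
  ((c == a) && (d == b)) || ((c == b) && (d == a)).
Proof.
apply/eqP/idP => [e|/orP[] /andP[/eqP -> /eqP ->] //]; last exact: addmC.
have := congr1 (fun m : 'X_{1..n} => m c) e.
rewrite /= !mnmDE !mnm1E eqxx [a == c]eq_sym [b == c]eq_sym.
case: (eqVneq c a) => [ca|_] /=.
  rewrite ca in e; move/eqP: e; rewrite eqm_add2l eq_mnm1 => /eqP ->.
  by rewrite eqxx.
case: (eqVneq c b) => [cb|_] //= _.
rewrite cb [RHS]addmC in e; move/eqP: e; rewrite eqm_add2l eq_mnm1 => /eqP ->.
by rewrite eqxx.
Qed.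

Variable g : 'M[k]_n.

Let form j : {mpoly k[n]} := \sum_(i < n) g i j *: 'X_i.

Lemma qmul_formE j i : qmul q (form j) (form i) =
  \sum_(c < n) \sum_(d < n)
    (g c j * g d i * qcoef q U_(c)%MM U_(d)%MM) *: 'X_[U_(c) + U_(d)].
Proof.
rewrite qmulE -[tmul _ _ _]/(tmulr _ _ _) /form linear_sum; apply: eq_bigr => c _.
rewrite linearZ /= /tmulr (linear_sum (tmul _ _)) scaler_sumr.
by apply: eq_bigr => d _; rewrite linearZ /= tmulXX !scalerA.
Qed.

Lemma mcoeff_qmul_form j i m : (qmul q (form j) (form i))@_m =
  \sum_(c < n) \sum_(d < n)
    g c j * g d i * qcoef q U_(c)%MM U_(d)%MM * ((U_(c) + U_(d))%MM == m)%:R.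
Proof.
rewrite qmul_formE linear_sum; apply: eq_bigr => c _; rewrite linear_sum.
by apply: eq_bigr => d _; rewrite linearZ /= mcoeffX.
Qed.

Lemma mcoeff_qmul_form_sqr j i a :
  (qmul q (form j) (form i))@_(U_(a) + U_(a)) = g a j * g a i.
Proof.
rewrite mcoeff_qmul_form (bigD1 a) //= [X in _ + X]big1 => [|c ca]; last first.
  by rewrite big1 // => d _; rewrite mnmUU_eq (negPf ca) mulr0.
rewrite addr0 (bigD1 a) //= big1 => [|d da]; last first.
  by rewrite mnmUU_eq (negPf da) andbF mulr0.
by rewrite eqxx qcoefUU ltnn !mulr1 addr0.
Qed.

Lemma mcoeff_qmul_form_mix j i a b : a != b ->
  (qmul q (form j) (form i))@_(U_(a) + U_(b)) =
  (g a j * g b i + q a b * (g b j * g a i)) * qcoef q U_(a)%MM U_(b)%MM.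
Proof.
move=> ab; rewrite mcoeff_qmul_form (bigD1 a) //= [X in _ + X](bigD1 b) 1?eq_sym //= addrA.
rewrite [X in _ + X]big1 => [|c /andP[ca cb]]; last first.
  by rewrite big1 // => d _; rewrite mnmUU_eq (negPf ca) (negPf cb) mulr0.
rewrite addr0 (bigD1 b) //= big1 => [|d db]; last first.
  by rewrite mnmUU_eq (negPf db) (negPf ab) andbF mulr0.
rewrite (bigD1 a) //= big1 => [|d da]; last first.
  by rewrite mnmUU_eq (negPf da) [b == a]eq_sym (negPf ab) andbF mulr0.
rewrite !mnmUU_eq !eqxx /= orbT !mulr1 !addr0 (qcoefUUC a b); ring.
Qed.

Lemma AutGr_linear : AutGr q g -> exists f : {linear {mpoly k[n]} -> {mpoly k[n]}},
  [/\ injective f, {morph f : p p' / qmul q p p'} & forall j, f 'X_j = form j].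
Proof.
case=> f [[flin fbij _ fM _] fX].
pose F : {linear {mpoly k[n]} -> {mpoly k[n]}} :=
  HB.pack f (GRing.isLinear.Build k _ _ *:%R f flin).
by exists F; split=> //; exact: bij_inj fbij.
Qed.

(** A row vector killed by [g^T] gives a linear form killed by the automorphism, which is
    injective. *)
Lemma AutGr_unitmx : AutGr q g -> g \in unitmx.
Proof.
case/AutGr_linear=> f [finj _ fX].
rewrite -unitmx_tr -row_free_unit -kermx_eq0; apply/rowV0P => u /sub_kermxP ug.
have : f (\sum_j u 0 j *: 'X_j) = f 0.
  rewrite linear0 linear_sum.
  under eq_bigr => j _ do rewrite linearZ /= fX /form scaler_sumr.
  rewrite exchange_big big1 // => i _.
  under eq_bigr => j _ do rewrite scalerA.
  have := congr1 (fun M : 'rV_n => M 0 i) ug; rewrite !mxE => e.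
  rewrite -scaler_suml [X in X *: _](_ : _ = 0) ?scale0r // -[RHS]e.
  by apply: eq_bigr => j _; rewrite [in RHS]mxE.
move/finj/(congr1 (fun p : {mpoly k[n]} => p@_U_(_)%MM)) => e.
apply/rowP => l; rewrite mxE; have := e l; rewrite mcoeff0 linear_sum => <-.
rewrite (bigD1 l) //= linearZ /= mcoeffX eqxx mulr1 big1 ?addr0 // => j jl.
by rewrite linearZ /= mcoeffX eq_mnm1 (negPf jl) mulr0.
Qed.

Lemma AutGr_commute : AutGr q g -> forall i j,
  qmul q (form j) (form i) = q i j *: qmul q (form i) (form j).
Proof.
case/AutGr_linear=> f [_ fM fX] i j.
by rewrite -!fX -!fM -linearZ !qmulE !tmulXX /= qcoefUUC scalerA (addmC U_(j)%MM).
Qed.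

(** Compare the coefficients of v_a^2 in the image of v_j v_i = q_ij v_i v_j. *)
Lemma AutGr_disjoint : AutGr q g ->
  forall a i j, q i j != 1 -> g a i * g a j = 0.
Proof.
move=> gA a i j qij; have := congr1 (mcoeff (U_(a) + U_(a))%MM) (AutGr_commute gA i j).
rewrite linearZ /= !mcoeff_qmul_form_sqr mulrC => /eqP.
rewrite -subr_eq0 -[X in X - _]mul1r -mulrBl mulf_eq0 subr_eq0 eq_sym (negPf qij).
by move/eqP.
Qed.

(** Compare the coefficients of v_a v_b in the same relation and cancel the common structure
    constant. *)
Lemma AutGr_minor : AutGr q g -> forall a b i j, a != b ->
  g a j * g b i + q a b * (g b j * g a i) =
  q i j * (g a i * g b j + q a b * (g b i * g a j)).
Proof.
move=> gA a b i j ab; apply: (mulIf (qcoefUU_neq0 a b)).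
rewrite -mulrA -!mcoeff_qmul_form_mix //.
by rewrite AutGr_commute // linearZ.
Qed.

Lemma unitmx_row_neq0 a : g \in unitmx -> exists i, g a i != 0.
Proof.
move=> gU; apply/existsP; apply: contraLR gU => /existsPn g0.
rewrite -row_free_unit; apply/negP => /row_freeP[h gh].
have := congr1 (fun M : 'M_n => M a a) gh; rewrite !mxE eqxx big1.
  by move/eqP; rewrite eq_sym oner_eq0.
by move=> i _; have := g0 i; rewrite negbK => /eqP ->; rewrite mul0r.
Qed.

Lemma AutGr_col_commute : AutGr q g -> forall a b i,
  g a i != 0 -> g b i != 0 -> q a b = 1.
Proof.
move=> gA a b i ai bi; apply/eqP/negPn/negP => qab.
have ab : a != b by apply: contraNneq qab => ->; rewrite qP.1.
(* Otherwise rows [a] and [b] of [g] are proportional. *)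
have prop j : g b i * g a j = g a i * g b j.
  have [qij|qij] := eqVneq (q i j) 1; last first.
    have := AutGr_disjoint gA a qij; have := AutGr_disjoint gA b qij.
    move=> /eqP; rewrite mulf_eq0 (negPf bi) => /eqP ->.
    by move=> /eqP; rewrite mulf_eq0 (negPf ai) => /eqP ->; rewrite !mulr0.
  have := AutGr_minor gA i j ab; rewrite qij mul1r => e.
  apply/eqP; rewrite -subr_eq0; have : (1 - q a b) * (g b i * g a j - g a i * g b j) = 0.
    by move/eqP: e; rewrite -subr_eq0 => /eqP <-; ring.
  by move/eqP; rewrite mulf_eq0 [1 - _ == 0]subr_eq0 [1 == _]eq_sym (negPf qab).
have gU := AutGr_unitmx gA.
(* The proportionality of the two rows as a vector in the left kernel of [g]; its coordinate at [a]
   is the nonzero entry g_bi. *)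
pose u : 'rV_n := g b i *: delta_mx 0 a - g a i *: delta_mx 0 b.
have u0 : u *m g = 0.
  by apply/rowP => j; rewrite mulmxBl -!scalemxAl -!rowE !mxE prop subrr.
have : u 0 a = 0 by rewrite -[u](mulmxK gU) u0 mul0mx mxE.
rewrite !mxE !eqxx (negPf ab) mulr1 mulr0 subr0 => /eqP.
by rewrite (negPf bi).
Qed.

Lemma AutGr_support : AutGr q g -> forall a b i j,
  g a i != 0 -> g b j != 0 -> q a b = q i j.
Proof.
move=> gA a b i j ai bj.
have [ab|ab] := eqVneq a b; first rewrite {1}ab.
  rewrite qP.1; have [->//|/(AutGr_disjoint gA b)/eqP] := eqVneq (q i j) 1.
  by rewrite -ab mulf_eq0 (negPf ai) ab (negPf bj).
have e := AutGr_minor gA j i ab.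
(* If q_ij = 1 and q_ab <> 1, the coefficient relation gives g_aj g_bi = g_ai g_bj <> 0, so column i
   meets both rows a and b, against [AutGr_col_commute]. *)
have [qij|qij] := eqVneq (q i j) 1.
  rewrite qij; apply/eqP/negPn/negP => qab.
  suff bi : g b i != 0 by rewrite (AutGr_col_commute gA ai bi) eqxx in qab.
  have qji : q j i = 1 by have := qP.2 i j; rewrite qij mul1r.
  have : (1 - q a b) * (g a i * g b j - g a j * g b i) = 0.
    by move/eqP: e; rewrite qji -subr_eq0 => /eqP <-; ring.
  move/eqP; rewrite mulf_eq0 !subr_eq0 [1 == _]eq_sym (negPf qab) => /eqP e'.
  by have := mulf_neq0 ai bj; rewrite e' mulf_eq0 negb_or => /andP[].
(* Here g_aj = 0, and the surviving terms of the coefficient relation give q_ji q_ab = 1. *)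
have /eqP := AutGr_disjoint gA a qij; rewrite mulf_eq0 (negPf ai) => /eqP aj0.
move/eqP: e; rewrite aj0 mulr0 mul0r mulr0 addr0 add0r mulrA [g b j * _]mulrC.
rewrite -subr_eq0 -[X in X - _]mul1r -mulrBl mulf_eq0 (negPf (mulf_neq0 ai bj)).
rewrite orbF subr_eq0 => /eqP e.
by apply: (mulfI (qparam_neq0 j i)); rewrite -e qP.2.
Qed.

End QuadraticRelations.

(** * The stabilizer, and the block permutation induced by an automorphism *)

Section Stabilizer.
Lemma map_enum_constant (T : finType) (U : eqType) (A : {set T}) (f : T -> U) (c : U) :
  {in A, forall x, f x = c} -> map f (enum A) = nseq #|A| c.
Proof.
move=> fc; rewrite cardE -(size_map f); apply/all_pred1P/allP => _ /mapP[x xA ->].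
by rewrite /= fc // -mem_enum.
Qed.

Lemma nseq_head (T : Type) (c c' : nat) (x y : T) :
  (0 < c)%N -> nseq c x = nseq c' y -> x = y.
Proof. by case: c => // c _; case: c' => // c' []. Qed.

Variables (k : fieldType) (n : nat) (q : 'M[k]_n) (r : nat) (blk : 'I_n -> 'I_r).
Local Notation B := (blockset blk).

Lemma group_set_Stab : group_set (Stab q blk).
Proof.
apply/group_setP; split=> [|s t].
  by rewrite inE; apply/andP; split; apply/forallP => a; rewrite ?perm1 //;
     apply/forallP => b; rewrite !perm1.
rewrite !inE => /andP[/forallP sC /forallP sQ] /andP[/forallP tC /forallP tQ].
apply/andP; split; apply/forallP => a; rewrite ?permM.
  by rewrite (eqP (tC _)).
apply/forallP => b; rewrite !permM.
by rewrite (eqP (forallP (sQ a) b)) (eqP (forallP (tQ (s a)) (s b))).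
Qed.

Lemma orbits_refine_Stab : orbits_refine q blk (Stab q blk).
Proof.
move=> [a b] [c d] [s]; rewrite inE => /andP[_ /forallP sQ] [<- <-].
exact: (forallP (sQ a) b).
Qed.

(** Equality of the submatrices at a diagonal pair (a, a) compares their numbers of rows, which
    yields the size condition. *)
Lemma sub_Stab (H : {set 'S_r}) : orbits_refine q blk H -> H \subset Stab q blk.
Proof.
move=> Hr; apply/subsetP => s sH; have e a b : Prel q blk (a, b) (s a, s b).
  by apply: Hr; exists s.
rewrite inE; apply/andP; split; apply/forallP => a; last by apply/forallP => b; apply: e.
have /eqP/(congr1 size) := e a a.
by rewrite !size_map -!cardE => ->.
Qed.

Hypotheses (qP : qparam q) (blkP : block_labeling q blk).

Lemma blk_row (i j : 'I_n) : reflect (forall l, q i l = q j l) (blk i == blk j).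
Proof.
apply: (iffP eqP) => [/blkP.2/rowP e l|e]; first by have := e l; rewrite !mxE.
by apply/blkP.2/rowP => l; rewrite !mxE.
Qed.

Lemma qparam_eqV (i j i' j' : 'I_n) : q i j = q i' j' -> q j i = q j' i'.
Proof.
by move=> e; apply: (mulfI (qparam_neq0 qP i j)); rewrite qP.2 e qP.2.
Qed.

(** Indices with equal rows also have equal columns, since q_ij determines q_ji. *)
Lemma q_blk (i j i' j' : 'I_n) : blk i = blk i' -> blk j = blk j' -> q i j = q i' j'.
Proof.
move=> /eqP/blk_row -> /eqP/blk_row e.
by apply: qparam_eqV.
Qed.

Lemma card_block_gt0 x : (0 < #|B x|)%N.
Proof. by have [i bi] := blkP.1 x; apply/card_gt0P; exists i; rewrite inE bi. Qed.

Lemma subq_block (i j : 'I_n) :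
  Defs.subq q (B (blk i)) (B (blk j)) =
  nseq #|B (blk i)| (nseq #|B (blk j)| (q i j)).
Proof.
apply: map_enum_constant => i'; rewrite inE => /eqP bi.
apply: map_enum_constant => j'; rewrite inE => /eqP bj.
exact: q_blk.
Qed.

(** Blocks are nonempty and the submatrices constant, so equality of submatrices amounts to equality
    of shapes and of one entry. *)
Lemma StabP (s : 'S_r) : reflect
  ((forall x, #|B (s x)| = #|B x|) /\
   forall i j i' j' : 'I_n, blk i' = s (blk i) -> blk j' = s (blk j) -> q i' j' = q i j)
  (s \in Stab q blk).
Proof.
rewrite inE; apply: (iffP andP) => -[sC sQ]; split.
- by move=> x; apply/eqP/(forallP sC).
- move=> i j i' j' bi bj.
  have /eqP := forallP (forallP sQ (blk i)) (blk j); rewrite -bi -bj !subq_block.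
  by move/(nseq_head (card_block_gt0 _))/(nseq_head (card_block_gt0 _)) ->.
- by apply/forallP => x; rewrite sC.
apply/forallP => x; apply/forallP => y.
have [i <-] := blkP.1 x; have [j <-] := blkP.1 y.
have [i' bi] := blkP.1 (s (blk i)); have [j' bj] := blkP.1 (s (blk j)).
by rewrite -bi -bj !subq_block bi bj !sC (sQ _ _ _ _ bi bj).
Qed.

(** Here f v_i = sum_a g_ai v_a maps the span of block [s x] to that of block [x]:
    [s] is the inverse of the permutation induced by [g], because MathComp composes
    permutations from left to right. *)
Definition block_support (s : 'S_r) (g : 'M[k]_n) :=
  forall a i, g a i != 0 -> blk i = s (blk a).

Lemma block_support_AutGr s g :
  s \in Stab q blk -> g \in unitmx -> block_support s g -> AutGr q g.
Proof.
move=> /StabP[_ sQ] gU gs.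
have rep_ex x : exists i, blk i == x by have [i <-] := blkP.1 x; exists i.
pose rep x := xchoose (rep_ex x).
have repE x : blk (rep x) = x by apply/eqP; exact: xchooseP (rep_ex x).
(* The source is labeled by [blk] and the target by [s \o blk]; both labelings express [q] through
   the same function on labels because [s] stabilizes [q]. *)
apply: (@subst_mx_AutGr _ _ _ q qP (fun x y => q (rep x) (rep y)) g blk (s \o blk)) => //=.
- by move=> i j; apply: q_blk; rewrite repE.
- by move=> i j; apply/esym/sQ; rewrite repE.
Qed.

Lemma AutGr_block_support g : AutGr q g ->
  exists2 s, s \in Stab q blk & block_support s g.
Proof.
move=> gA; have gU := AutGr_unitmx gA.
have gTU : g^T \in unitmx by rewrite unitmx_tr.
(* [AutGr_support] transfers entries of [q] between rows a and i; invertibility supplies a nonzero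
   entry in each row of [g] for one direction and in each column for the other. *)
have row_eq a a' i i' : g a i != 0 -> g a' i' != 0 -> (blk i == blk i') = (blk a == blk a').
  move=> ai ai'; apply/blk_row/blk_row => e l.
    have [j lj] := unitmx_row_neq0 l gU.
    by rewrite (AutGr_support qP gA ai lj) (AutGr_support qP gA ai' lj).
  have [b bl] := unitmx_row_neq0 l gTU; rewrite mxE in bl.
  by rewrite -(AutGr_support qP gA ai bl) -(AutGr_support qP gA ai' bl).
have ex x : exists p : 'I_n * 'I_n, (blk p.1 == x) && (g p.1 p.2 != 0).
  have [a <-] := blkP.1 x; have [i ai] := unitmx_row_neq0 a gU.
  by exists (a, i); rewrite eqxx.
(* The block of the column of some nonzero entry in block row [x]; by [row_eq] it is independent of
   the choice and injective in [x]. *)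
pose s0 x := blk (xchoose (ex x)).2.
have s0P a i : g a i != 0 -> blk i = s0 (blk a).
  have /andP[/eqP b1 g1] := xchooseP (ex (blk a)) => ai.
  by apply/eqP; rewrite (row_eq _ _ _ _ ai g1) b1.
have s0_inj : injective s0.
  move=> x y /eqP; have /andP[/eqP b1 g1] := xchooseP (ex x).
  have /andP[/eqP b2 g2] := xchooseP (ex y).
  by rewrite (row_eq _ _ _ _ g1 g2) b1 b2 => /eqP.
have s0E x : perm s0_inj x = s0 x by rewrite permE.
exists (perm s0_inj) => [|a i ai]; last by rewrite s0E (s0P _ _ ai).
apply/StabP; split=> [x|i j i' j'].
  (* A nonzero term of the Leibniz expansion of the determinant. *)
  have /existsP[p /forallP p0] : [exists p : 'S_n, [forall a, g a (p a) != 0]].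
    apply: contraLR gU => /existsPn p0; rewrite unitmxE unitfE negbK.
    apply/eqP/big1 => p _; have /forallPn[a] := p0 p.
    by rewrite negbK => /eqP e; rewrite (bigD1 a) //= e mul0r mulr0.
  (* Every g_a,p(a) is nonzero, so [p] carries block [x] onto its image block. *)
  rewrite -(card_imset (B x) (@perm_inj _ p)); apply: eq_card => i; rewrite !inE s0E.
  rewrite -[i](permKV p) (mem_imset _ _ (@perm_inj _ p)) inE (s0P _ _ (p0 _)).
  exact: inj_eq.
rewrite !s0E => bi bj.
have [i0 ai] := unitmx_row_neq0 i gU; have [j0 aj] := unitmx_row_neq0 j gU.
rewrite (AutGr_support qP gA ai aj); apply: q_blk; [rewrite bi|rewrite bj].
  by rewrite (s0P _ _ ai).
by rewrite (s0P _ _ aj).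
Qed.

End Stabilizer.

(** * The semidirect product realized by block monomial matrices *)

Section BlockMatrices.
Variables (k : fieldType) (n r : nat) (blk : 'I_n -> 'I_r).
Variables (s : nat) (lam : 'I_s -> nat) (ty : 'I_r -> 'I_s).
Local Notation B := (blockset blk).
Hypothesis lam_ty : forall x, lam (ty x) = #|B x|.

Definition size_class (i : 'I_s) : {set 'I_r} := [set x | ty x == i].

Definition mult (i : 'I_s) : nat := #|size_class i|.

Definition block_at (i : 'I_s) (c : 'I_(mult i)) : 'I_r := enum_val c.

Lemma ty_block_at i (c : 'I_(mult i)) : ty (block_at c) = i.
Proof. by have := enum_valP c; rewrite inE => /eqP. Qed.

Lemma block_at_inj i : injective (@block_at i).
Proof. exact: enum_val_inj. Qed.

Lemma block_at_surj x : exists c : 'I_(mult (ty x)), block_at c = x.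
Proof.
have xC : x \in size_class (ty x) by rewrite inE.
by exists (enum_rank_in xC x); apply: enum_rankK_in.
Qed.

Lemma card_block_at i (c : 'I_(mult i)) : lam i = #|B (block_at c)|.
Proof. by rewrite -lam_ty ty_block_at. Qed.

Lemma sum_mult (F : 'I_r -> nat) (f : 'I_s -> nat) :
  (forall x, F x = f (ty x)) -> (\sum_i mult i * f i = \sum_x F x)%N.
Proof.
move=> Ff; rewrite [RHS](partition_big ty xpredT) //=; apply: eq_bigr => i _.
rewrite (eq_bigr (fun => f i)) => [|x /eqP <-]; last exact: Ff.
by rewrite sum_nat_const; congr (_ * _)%N; apply: eq_card => x; rewrite !inE.
Qed.

(** Positions are typed by [lam i] rather than by the cardinality of the block, so that all blocks
    of one class carry matrices of one type and can be permuted. *)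
Definition index_at (i : 'I_s) (c : 'I_(mult i)) (u : 'I_(lam i)) : 'I_n :=
  enum_val (cast_ord (card_block_at c) u).

Lemma blk_index_at i (c : 'I_(mult i)) u : blk (index_at c u) = block_at c.
Proof. by have := enum_valP (cast_ord (card_block_at c) u); rewrite inE => /eqP. Qed.

Lemma index_at_inj i (c : 'I_(mult i)) : injective (index_at c).
Proof. by move=> u v /enum_val_inj/cast_ord_inj. Qed.

Lemma index_at_surj p : exists i (c : 'I_(mult i)) u, index_at c u = p.
Proof.
have [c cp] := block_at_surj (blk p); exists (ty (blk p)), c.
have pB : p \in B (block_at c) by rewrite inE cp.
exists (cast_ord (esym (card_block_at c)) (enum_rank_in pB p)).
by rewrite /index_at cast_ordKV enum_rankK_in.
Qed.

Definition incl_mx i (c : 'I_(mult i)) : 'M[k]_(n, lam i) :=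
  \matrix_(p, u) (p == index_at c u)%:R.

Lemma incl_trE i (c : 'I_(mult i)) h (M : 'M[k]_(n, h)) u v :
  ((incl_mx c)^T *m M) u v = M (index_at c u) v.
Proof.
rewrite mxE (bigD1 (index_at c u)) //= !mxE eqxx mul1r big1 ?addr0 // => p pu.
by rewrite !mxE (negPf pu) mul0r.
Qed.

Lemma incl_mxK i (c : 'I_(mult i)) : (incl_mx c)^T *m incl_mx c = 1%:M.
Proof.
apply/matrixP => u v; rewrite incl_trE !mxE.
by rewrite (inj_eq (@index_at_inj i c)).
Qed.

Lemma incl_mx_ortho i (c : 'I_(mult i)) i' (c' : 'I_(mult i')) :
  block_at c != block_at c' -> (incl_mx c)^T *m incl_mx c' = 0.
Proof.
move=> cc'; apply/matrixP => u v; rewrite incl_trE !mxE.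
by case: eqP => // /(congr1 blk); rewrite !blk_index_at => /eqP; rewrite (negPf cc').
Qed.

Lemma incl_mx_support i (c : 'I_(mult i)) h (M : 'M[k]_(h, n)) :
  (forall u p, M u p != 0 -> blk p = block_at c) ->
  M *m incl_mx c *m (incl_mx c)^T = M.
Proof.
move=> Mc; apply/matrixP => u p; rewrite mxE.
have MI v : (M *m incl_mx c) u v = M u (index_at c v).
  rewrite mxE (bigD1 (index_at c v)) //= !mxE eqxx mulr1 big1 ?addr0 // => p' pv.
  by rewrite mxE (negPf pv) mulr0.
have [pc|pc] := eqVneq (blk p) (block_at c).
  have pB : p \in B (block_at c) by rewrite inE pc.
  pose v0 := cast_ord (esym (card_block_at c)) (enum_rank_in pB p).
  have v0E : index_at c v0 = p by rewrite /index_at cast_ordKV enum_rankK_in.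
  rewrite (bigD1 v0) //= MI !mxE v0E eqxx mulr1 big1 ?addr0 // => v vv0.
  by rewrite !mxE -v0E (inj_eq (@index_at_inj i c)) eq_sym (negPf vv0) mulr0.
rewrite big1 => [|v _]; last first.
  rewrite !mxE; case: eqP => [e|_]; last by rewrite mulr0.
  by rewrite e blk_index_at eqxx in pc.
by apply/esym/eqP; apply: contraNT pc => /Mc ->.
Qed.

(** The blocks cover all indices, so matrices can be compared one block row at a time. *)
Lemma eq_incl_mx h (M N : 'M[k]_(n, h)) :
  (forall i (c : 'I_(mult i)), (incl_mx c)^T *m M = (incl_mx c)^T *m N) -> M = N.
Proof.
move=> MN; apply/matrixP => p v; have [i [c [u <-]]] := index_at_surj p.
by rewrite -!incl_trE MN.
Qed.

(** Junk value: the identity, when [sg] does not permute the blocks of size [lam i]. *)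
Definition class_perm (i : 'I_s) (sg : 'S_r) : {perm 'I_(mult i)} :=
  @insubd _ _ {perm 'I_(mult i)} 1%g
    [ffun c : 'I_(mult i) => enum_rank_in (enum_valP c) (sg (block_at c))].

Definition ty_preserving (sg : 'S_r) := forall x, ty (sg x) = ty x.

Lemma block_at_class_perm i sg (c : 'I_(mult i)) :
  ty_preserving sg -> block_at (class_perm i sg c) = sg (block_at c).
Proof.
move=> sgT; pose f := [ffun c : 'I_(mult i) => enum_rank_in (enum_valP c) (sg (@block_at i c))].
have fE c0 : block_at (f c0) = sg (block_at c0).
  by rewrite ffunE; apply: enum_rankK_in; rewrite inE sgT ty_block_at.
have finj : injectiveb f.
  apply/injectiveP => c1 c2 /(congr1 (@block_at i)); rewrite !fE.
  by move/perm_inj/block_at_inj.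
by rewrite -fE /class_perm -/f -pvalE val_insubd finj.
Qed.

Lemma class_permM i sg tau : ty_preserving sg -> ty_preserving tau ->
  class_perm i (sg * tau)%g = (class_perm i sg * class_perm i tau)%g.
Proof.
move=> sgT tauT; apply/permP => c; apply: block_at_inj.
rewrite permM !block_at_class_perm // ?permM //.
by move=> x; rewrite permM tauT sgT.
Qed.

Lemma class_perm1 i : class_perm i 1%g = 1%g.
Proof.
apply/permP => c; apply: block_at_inj.
by rewrite block_at_class_perm ?perm1 // => x; rewrite perm1.
Qed.

Lemma class_perm_faithful sg tau : ty_preserving sg -> ty_preserving tau ->
  (forall i (c : 'I_(mult i)), class_perm i sg c = class_perm i tau c) -> sg = tau.
Proof.
move=> sgT tauT e; apply/permP => x; have [c <-] := block_at_surj x.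
by rewrite -!block_at_class_perm // e.
Qed.

(** The block monomial matrix whose block row [c] has [x i c] in block column [class_perm i sg c]
    and zeros elsewhere. *)
Definition assemble (x : GLfam k lam mult) (sg : 'S_r) : 'M[k]_n :=
  \sum_i \sum_c incl_mx c *m x i c *m (incl_mx (class_perm i sg c))^T.

Lemma assemble_block x sg i (c : 'I_(mult i)) :
  (incl_mx c)^T *m assemble x sg = x i c *m (incl_mx (class_perm i sg c))^T.
Proof.
rewrite mulmx_sumr (bigD1 i) //= [X in _ + X]big1 => [|i' ii']; last first.
  rewrite mulmx_sumr big1 // => c' _; rewrite !mulmxA incl_mx_ortho ?mul0mx //.
  by apply: contraNneq ii' => e; rewrite -(ty_block_at c) e ty_block_at.
rewrite addr0 mulmx_sumr (bigD1 c) //= big1 => [|c' cc']; last first.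
  rewrite !mulmxA incl_mx_ortho ?mul0mx //.
  by rewrite (inj_eq (@block_at_inj i)) eq_sym.
by rewrite addr0 !mulmxA incl_mxK mul1mx.
Qed.

(** Block row [c] of the first factor selects the block row of [y] at the image of [c] under [sg];
    this shift is the twist [GLact], and the block column is then moved by [tau]. *)
Lemma assembleM x sg y tau : ty_preserving sg -> ty_preserving tau ->
  assemble (GLmul x (GLact class_perm sg y)) (sg * tau)%g =
  assemble x sg *m assemble y tau.
Proof.
move=> sgT tauT; apply: eq_incl_mx => i c.
rewrite mulmxA !assemble_block -!mulmxA assemble_block.
by rewrite class_permM // permM mulmxA.
Qed.

Lemma assemble1 x : (forall i c, x i c = 1%:M) -> assemble x 1%g = 1%:M.
Proof.
move=> x1; apply: eq_incl_mx => i c.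
by rewrite assemble_block x1 class_perm1 perm1 mul1mx mulmx1.
Qed.

Lemma ty_preservingV sg : ty_preserving sg -> ty_preserving sg^-1%g.
Proof. by move=> sgT x; rewrite -{2}[x](permKV sg) sgT. Qed.

Lemma assemble_unitmx x sg : ty_preserving sg -> inGL x -> assemble x sg \in unitmx.
Proof.
move=> sgT xU; have sgVT := ty_preservingV sgT.
(* The first component of the inverse of (x, sg) in the semidirect product. *)
pose y : GLfam k lam mult := fun i c => invmx (x i (class_perm i sg^-1%g c)).
have : assemble x sg *m assemble y sg^-1%g = 1%:M.
  rewrite -assembleM // mulgV assemble1 // => i c; rewrite /GLmul /GLact /y.
  by rewrite -permM -class_permM // mulgV class_perm1 perm1 mulmxV.
by case/mulmx1_unit.
Qed.

Lemma assemble_entry x sg i (c : 'I_(mult i)) :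
  (incl_mx c)^T *m assemble x sg *m incl_mx (class_perm i sg c) = x i c.
Proof. by rewrite assemble_block -mulmxA incl_mxK mulmx1. Qed.

Lemma assemble_inj x sg y tau : (forall i, (0 < lam i)%N) ->
  ty_preserving sg -> ty_preserving tau -> inGL x -> inGL y ->
  assemble x sg = assemble y tau -> (forall i c, x i c = y i c) /\ sg = tau.
Proof.
move=> lam_gt0 sgT tauT xU yU e.
(* If the permutations differed at [c], the invertible block [x i c] would sit where
   [assemble y tau] vanishes; positivity of [lam i] excludes the invertible empty matrix. *)
have perm_eq i (c : 'I_(mult i)) : class_perm i sg c = class_perm i tau c.
  apply/eqP/negPn/negP => cc'; have := xU i c.
  rewrite -(assemble_entry x sg) e assemble_block -mulmxA incl_mx_ortho ?mulmx0; last first.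
    by rewrite (inj_eq (@block_at_inj i)) eq_sym.
  by case: (lam i) (lam_gt0 i) => // l _; rewrite unitmxE det0 unitr0.
split=> [i c|]; last exact: class_perm_faithful perm_eq.
by rewrite -(assemble_entry x sg) e perm_eq assemble_entry.
Qed.

Lemma assemble_support x sg : ty_preserving sg -> block_support blk sg (assemble x sg).
Proof.
move=> sgT p p'; have [i [c [u <-]]] := index_at_surj p.
rewrite -incl_trE assemble_block blk_index_at -block_at_class_perm //.
apply: contraNeq => pc; rewrite mxE big1 // => v _; rewrite !mxE.
case: eqP => [e|_]; last by rewrite mulr0.
by rewrite e blk_index_at eqxx in pc.
Qed.

Lemma assemble_surj g sg : ty_preserving sg -> g \in unitmx ->
  block_support blk sg g -> exists2 x, inGL x & assemble x sg = g.
Proof.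
move=> sgT gU gs.
pose x : GLfam k lam mult :=
  fun i c => (incl_mx c)^T *m g *m incl_mx (class_perm i sg c).
have xI i c : x i c *m (incl_mx (class_perm i sg c))^T = (incl_mx c)^T *m g.
  apply: incl_mx_support => u p; rewrite incl_trE => /gs.
  by rewrite blk_index_at block_at_class_perm.
exists x => [i c|]; last by apply: eq_incl_mx => i c; rewrite assemble_block xI.
(* The inverse of a block of [g] is the block of [invmx g] in the transposed position. *)
have : x i c *m ((incl_mx (class_perm i sg c))^T *m invmx g *m incl_mx c) = 1%:M.
  by rewrite !mulmxA xI -(mulmxA _ g) mulmxV // mulmx1 incl_mxK.
by case/mulmx1_unit.
Qed.

End BlockMatrices.

(** * The partition by block sizes and the isomorphism *)

Lemma distinct_values (r : nat) (f : 'I_r -> nat) :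
  exists s (lam : 'I_s -> nat) (ty : 'I_r -> 'I_s),
    [/\ injective lam, forall i, exists x, ty x = i & forall x, lam (ty x) = f x].
Proof.
pose vals := undup (codom f).
have vals_f x : f x \in vals by rewrite mem_undup codom_f.
pose ty x : 'I_(size vals) := Ordinal (etrans (index_mem (f x) vals) (vals_f x)).
have tyE x : nth 0%N vals (ty x) = f x by apply: nth_index.
exists (size vals), (fun i => nth 0%N vals i), ty.
have lam_inj : injective (fun i : 'I_(size vals) => nth 0%N vals i).
  by move=> i j /eqP; rewrite nth_uniq ?undup_uniq // => /eqP/val_inj.
split=> // i.
have : nth 0%N vals i \in codom f by rewrite -mem_undup mem_nth.
by case/codomP=> x e; exists x; apply: lam_inj; rewrite e tyE.
Qed.

Theorem theorem2p9 (k : fieldType) (n : nat) (q : 'M[k]_n)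
    (r : nat) (blk : 'I_n -> 'I_r) :
  qparam q -> block_labeling q blk ->
  (* G = Stab(q) is the maximal subgroup of S_r whose orbit space on [r]^2
     refines P *)
  (group_set (Stab q blk) /\ orbits_refine q blk (Stab q blk) /\
   forall H : {group 'S_r}, orbits_refine q blk H -> H \subset Stab q blk) /\
  (* Aut_gr(S_q(V)) ~= (prod_i GL(lam_i,k)^{m_i}) x| G *)
  exists (s : nat) (lam m : 'I_s -> nat),
    [/\ forall i, (0 < lam i)%N, injective lam, forall i, (0 < m i)%N,
        (\sum_(i < s) m i)%N = r & (\sum_(i < s) m i * lam i)%N = n] /\
    exists (rho : forall i : 'I_s, 'S_r -> {perm 'I_(m i)})
           (phi : GLfam k lam m -> 'S_r -> 'M[k]_n),
    ((* G acts through a subgroup of prod_i S_{m_i} *)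
        (forall i, {in Stab q blk &, {morph rho i : x y / (x * y)%g}}) /\
        {in Stab q blk &, forall x y, (forall i, rho i x = rho i y) -> x = y}) /\
    [/\
        (* phi : semidirect product -> Aut_gr is a group isomorphism *)
        forall x sg, inGL x -> sg \in Stab q blk -> AutGr q (phi x sg),
        forall g, AutGr q g ->
          exists x sg, [/\ inGL x, sg \in Stab q blk & phi x sg = g],
        forall x sg y tau, inGL x -> sg \in Stab q blk ->
          inGL y -> tau \in Stab q blk -> phi x sg = phi y tau ->
          (forall i c, x i c = y i c) /\ sg = tau
      & forall x sg y tau, inGL x -> sg \in Stab q blk ->
          inGL y -> tau \in Stab q blk ->
          phi (GLmul x (GLact rho sg y)) (sg * tau)%g = phi x sg *m phi y tau].
Proof.
move=> qP blkP; split.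
  split; first exact: group_set_Stab.
  by split; [exact: orbits_refine_Stab | move=> H; exact: sub_Stab].
have [s [lam [ty [lam_inj ty_surj lam_ty]]]] :=
  distinct_values (fun x => #|blockset blk x|).
have lam_gt0 i : (0 < lam i)%N.
  by have [x <-] := ty_surj i; rewrite lam_ty (card_block_gt0 blkP).
(* As the parts are distinct, preserving block sizes is the same as preserving size classes. *)
have StabT sg : sg \in Stab q blk -> ty_preserving ty sg.
  by move=> /(StabP qP blkP)[sC _] x; apply: lam_inj; rewrite !lam_ty.
exists s, lam, (mult ty); split.
  split=> //.
  - move=> i; have [x <-] := ty_surj i.
    by apply/card_gt0P; exists x; rewrite inE.
  (* Weight one counts the r blocks; the weight [lam] used next adds up their sizes, which gives
     n. *)
  - have := sum_mult (F := fun=> 1%N) (f := fun=> 1%N) (fun _ => erefl) (ty := ty).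
    rewrite sum1_card card_ord; apply: etrans.
    by apply: eq_bigr => i _; rewrite muln1.
  - rewrite (sum_mult (F := fun x => #|blockset blk x|)) => [|x]; last by rewrite lam_ty.
    rewrite -[RHS]card_ord -sum1_card (partition_big blk xpredT) //=.
    apply: eq_bigr => x _; rewrite sum1_card; apply: eq_card => i.
    by rewrite !inE.
exists (class_perm ty), (assemble lam_ty); split.
  split=> [i sg tau /StabT sgT /StabT tauT|sg tau /StabT sgT /StabT tauT e].
    exact: class_permM.
  by apply: (class_perm_faithful sgT tauT) => i c; rewrite e.
split.
- move=> x sg xU sgS; have sgT := StabT _ sgS.
  apply: (block_support_AutGr qP blkP sgS); first exact: assemble_unitmx.
  exact: assemble_support.
- move=> g gA; have [sg sgS gs] := AutGr_block_support qP blkP gA.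
  have [x xU <-] := assemble_surj lam_ty (StabT _ sgS) (AutGr_unitmx gA) gs.
  by exists x, sg.
- move=> x sg y tau xU /StabT sgT yU /StabT tauT.
  exact: assemble_inj.
- move=> x sg y tau _ /StabT sgT _ /StabT tauT.
  exact: assembleM.
Qed.
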